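(* Let $f:\mathbb{T}^2\to\mathbb{T}^2$ be a $C^2$ Anosov endomorphism with constant Jacobian $|\det Df|$ whose unstable foliation has the UBD property, and let $F$, $\mathcal B_k$ and $m^k_x$ be as in the context. Then for every $k\ge 0$ and for $m$-almost every $x\in\mathcal B_k$, $$\frac{d m^k_x}{d\left(F^k_* m^0_{F^{-k}(x)}\right)}=1 .$$
   Context: Anosov endomorphism: a local $C^1$ diffeomorphism $f:M\to M$ of a closed Riemannian manifold such that for every full orbit $\tilde x=(x_i)_{i\in\mathbb{Z}}$ ($f(x_i)=x_{i+1}$) there is a splitting $T_{x_i}M=E^u(x_i)\oplus E^s(x_i)$, with $Df(x_i)E^{\sigma}(x_i)=E^{\sigma}(x_{i+1})$, and constants $c>0$, $\lambda>1$ such that for all $n\ge 0$ and all $i$: $\|Df^n(x_i)v\|\ge c^{-1}\lambda^n\|v\|$ for $v\in E^u(x_i)$ and $\|Df^n(x_i)v\|\le c\lambda^{-n}\|v\|$ for $v\in E^s(x_i)$. Standing convention: $E^s$ is nontrivial, so on $\mathbb{T}^2$ both $E^s$ and $E^u$ are one-dimensional. UBD property: a one-dimensional foliation $\mathcal F$ has the uniform bounded density property if there is $C>1$ such that, for every foliated box $\mathcal B$, the disintegration $\{m^{\mathcal B}_x\}$ of the volume normalized to $\mathcal B$ along local leaves satisfies $C^{-1}\le \frac{d m^{\mathcal B}_x}{d\hat\lambda^{\mathcal B}_x}\le C$, where $\hat\lambda^{\mathcal B}_x$ is the normalized length on the connected component of $\mathcal F(x)\cap\mathcal B$ containing $x$.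 For the unstable foliation of $f$ this means: the unstable foliation $W^u_F$ of a lift $F$ has it. Setting. $F:\mathbb{R}^2\to\mathbb{R}^2$ is a lift of $f$ (an Anosov diffeomorphism, with stable and unstable foliations $W^s_F$, $W^u_F$ having global product structure), normalized so that $F(0)=0$ and assumed to preserve the orientation of unstable leaves. $p:\mathbb{R}^2\to\mathbb{T}^2$ is the projection and $m$ is Lebesgue measure on $\mathbb{R}^2$. Let $B=W^s_F(0)$ ($F$-invariant, met by each unstable leaf at exactly one point), and $p^u_F:\mathbb{R}^2\to B$, $p^u_F(z)=W^u_F(z)\cap B$. Choose one side of $B$ as positive, and let $W^{u,+}_F$ denote the part of the unstable leaves on that side. Let $\delta_0>0$ be such that $\mathcal B_0=\{y\in W^{u,+}_F: d^u(p^u_F(y),y)\le\delta_0\}$ satisfies $p(\mathcal B_0)=\mathbb{T}^2$, where $d^u$ is distance along unstable leaves. Let $\mathcal B_k=F^k(\mathcal B_0)$ and $W_k(x)=W^u_F(x)\cap\mathcal B_k$. For $m$-almost every $x\in\mathcal B_k$, $m^k_x$ is the conditional probability measure on $W_k(x)$ obtained by disintegrating $m$, restricted to foliated boxes of the form $(p^u_F|_{\mathcal B_k})^{-1}(Y)$ with $Y\subset B$ a bounded open set and normalized, along the leaf segments $W_k(\cdot)$; it is uniquely determined for almost every leaf. *)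

(* Defs.v *)
From HB Require Import structures.
From mathcomp Require Import all_boot all_order all_algebra.
From mathcomp Require Import all_classical all_reals all_analysis.
From mathcomp Require Import measurable_realfun.

Set Implicit Arguments.
Unset Strict Implicit.
Unset Printing Implicit Defensive.

Import Order.TTheory GRing.Theory Num.Theory.
Import numFieldNormedType.Exports.

Local Open Scope classical_set_scope.
Local Open Scope ring_scope.
Local Open Scope quotient_scope.

(* The topology and the linear structure are those of [R * R] (max norm), the
   sigma-algebra is the product one, i.e. the Borel sigma-algebra of R^2. *)
Definition plane (R : realType) : Type :=
  (measurableTypeR R * measurableTypeR R)%type.
HB.instance Definition _ (R : realType) :=
  NormedModule.copy (plane R) (R * R)%type.
HB.instance Definition _ (R : realType) :=
  Measurable.copy (plane R) (measurableTypeR R * measurableTypeR R)%type.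

Definition leb (R : realType) : set (plane R) -> \bar R :=
  (@lebesgue_measure R \x @lebesgue_measure R)%E.
HB.instance Definition _ (R : realType) := Measure.on (@leb R).

Definition enorm (R : realType) (v : plane R) : R :=
  Num.sqrt (v.1 ^+ 2 + v.2 ^+ 2).

Definition latticeb (R : realType) : rel (plane R) :=
  fun x y => (x.1 - y.1 \is a Num.int) && (x.2 - y.2 \is a Num.int).

Lemma latticeb_equiv (R : realType) : equiv_class_of (@latticeb R).
Proof.
split=> [x|x y|y x z]; rewrite /latticeb.
- by rewrite !subrr !rpred0.
- by rewrite -[x.1 - y.1]opprB -[x.2 - y.2]opprB !rpredN.
- move=> /andP[xy1 xy2] /andP[yz1 yz2]; apply/andP; split.
    by rewrite -(subrKA y.1 x.1 (- z.1)) rpredD.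
  by rewrite -(subrKA y.2 x.2 (- z.2)) rpredD.
Qed.

Canonical latticeb_equivRel (R : realType) := EquivRelPack (@latticeb_equiv R).

Definition torus (R : realType) : Type := {eq_quot (@latticeb R)}.

Definition torus_proj (R : realType) (x : plane R) : torus R := \pi_(torus R) x.

Definition is_lift (R : realType) (f : torus R -> torus R)
    (F : plane R -> plane R) : Prop :=
  continuous F /\ forall x, torus_proj (F x) = f (torus_proj x).

Lemma open_measurable_plane (R : realType) (U : set (plane R)) :
  open U -> measurable U.
Proof.
move=> oU.
pose b (q : rat * rat * rat) :=
  ball ((ratr q.1.1, ratr q.1.2) : plane R) (ratr q.2).
have -> : U = \bigcup_(q in [set q | b q `<=` U]) b q.
  apply/seteqP; split => [x Ux|x [q /= qU]]; last exact: qU.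
  have /nbhs_ballP[e /= e0 eU] : nbhs x U by exact: open_nbhs_nbhs.
  have [r] : exists q : rat, ratr q \in `]0, e / 2[.
    by apply: rat_in_itvoo; rewrite divr_gt0.
  rewrite in_itv /= => /andP[r0 re].
  have near y : exists q : rat, `|ratr q - y| < ratr r :> R.
    have [q] : exists q : rat, ratr q \in `]y - ratr r, y + ratr r[.
      by apply: rat_in_itvoo; rewrite ltrD2l gtrN.
    by rewrite in_itv/= => q12; exists q; rewrite ltr_distl.
  have [q1 h1] := near x.1; have [q2 h2] := near x.2.
  have qx : b (q1, q2, r) x by split.
  exists (q1, q2, r) => // z qz; apply: eU.
  rewrite (splitr e).
  apply: (@le_ball _ _ x (ratr r + ratr r)); first by rewrite lerD// ltW.
  exact: ball_triangle (ball_sym qx) qz.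
rewrite bigcup_mkcond; apply: countable_bigcupT_measurable => // q.
case: ifP => // _.
rewrite [X in measurable X](_ : _ =
  ball (ratr q.1.1 : R) (ratr q.2) `*` ball (ratr q.1.2 : R) (ratr q.2));
  last first.
  by apply/seteqP; split => -[].
by apply: measurableX; apply: measurable_ball.
Qed.

Lemma continuous_plane_measurable (R : realType) (F : plane R -> plane R) :
  continuous F -> measurable_fun setT F.
Proof.
have openE (h : plane R -> R) : continuous h ->
    measurable_fun setT (h : plane R -> measurableTypeR R).
  move=> /continuousP ch; apply: (measurability _ (RGenOInfty.measurableE R)).
  move=> _ [_ [x ->] <-]; rewrite setTI.
  by apply: open_measurable_plane; apply: ch; apply: interval_open.
move=> cF; apply/measurable_fun_pairP; split; apply: openE => x;
  apply: continuous_comp (cF x) _; [exact: cvg_fst|exact: cvg_snd].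
Qed.

Lemma iter_continuous (T : topologicalType) (F : T -> T) (k : nat) :
  continuous F -> continuous (iter k F).
Proof.
move=> cF; elim: k => [|k IH] x; first exact: cvg_id.
exact: continuous_comp (IH x) (cF _).
Qed.

(* The k-th iterate of a lift, bundled as a measurable map so that
   [distribution] can push measures forward along it. *)
Definition lift_iter (R : realType) (f : torus R -> torus R)
    (F : plane R -> plane R) (liftF : is_lift f F) (k : nat) :
    plane R -> plane R :=
  iter k F.
HB.instance Definition _ (R : realType) (f : torus R -> torus R)
    (F : plane R -> plane R) (liftF : is_lift f F) (k : nat) :=
  isMeasurableFun.Build _ _ _ _ (lift_iter liftF k)
    (continuous_plane_measurable (iter_continuous (k := k) (proj1 liftF))).

Definition C1_on (R : realType) (U : set (plane R))
    (F : plane R -> plane R) : Prop :=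
  forall x, U x -> differentiable F x /\
    forall v, {for x, continuous (fun y => 'd F y v : plane R)}.

Definition C2 (R : realType) (F : plane R -> plane R) : Prop :=
  C1_on setT F /\ forall v, C1_on setT (fun x => 'd F x v : plane R).

Definition local_C1_diffeo (R : realType) (F : plane R -> plane R) : Prop :=
  forall x, exists (U : set (plane R)) (H : plane R -> plane R),
    [/\ open U /\ U x, open (F @` U), C1_on U F, C1_on (F @` U) H &
        forall y, U y -> H (F y) = y].

Definition jacobian (R : realType) (F : plane R -> plane R) (x : plane R) : R :=
  let a : plane R := 'd F x ((1, 0) : plane R) in
  let b : plane R := 'd F x ((0, 1) : plane R) in
  a.1 * b.2 - b.1 * a.2.

Definition constant_jacobian (R : realType) (F : plane R -> plane R) : Prop :=
  exists J : R, forall x, `|jacobian F x| = J.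

Definition is_line (R : realType) (E : set (plane R)) : Prop :=
  exists2 e : plane R, e != 0 & E = [set t *: e | t in [set: R]].

Definition direct_sum (R : realType) (E1 E2 : set (plane R)) : Prop :=
  forall v : plane R, exists! ab : plane R * plane R,
    [/\ E1 ab.1, E2 ab.2 & v = ab.1 + ab.2].

(* [F] is a lift of [f].  The tangent bundle of the torus is trivialised by
   [torus_proj], with the flat metric, so that [Df^n] at [t] is
   ['d (iter n F) x] for any [x] above [t], e.g. [repr t].  The splitting is
   indexed by [i], not by [x i]: it depends on the whole orbit.  Both summands
   are lines since the stable one is nontrivial by convention. *)
Definition anosov_endomorphism (R : realType) (f : torus R -> torus R)
    (F : plane R -> plane R) : Prop :=
  local_C1_diffeo F /\
  forall x : int -> torus R, (forall i, f (x i) = x (i + 1)) ->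
  exists Eu Es : int -> set (plane R),
  [/\ forall i, [/\ is_line (Eu i), is_line (Es i) & direct_sum (Eu i) (Es i)],
      forall i, 'd F (repr (x i)) @` Eu i = Eu (i + 1) /\
                'd F (repr (x i)) @` Es i = Es (i + 1) &
      exists c lambda : R, [/\ 0 < c, 1 < lambda,
        forall (n : nat) i v, Eu i v ->
          c^-1 * lambda ^+ n * enorm v <= enorm ('d (iter n F) (repr (x i)) v) &
        forall (n : nat) i v, Es i v ->
          enorm ('d (iter n F) (repr (x i)) v) <= c * lambda ^- n * enorm v]].

(* [stable_set F x] is the stable leaf of [x] for [F]; the unstable leaf is
   [stable_set G x] with [G] the inverse of [F].  Likewise for
   [stable_direction], which is the tangent line of the leaf. *)
Definition stable_set (R : realType) (F : plane R -> plane R) (x : plane R) :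
    set (plane R) :=
  [set y | (fun n => iter n F y - iter n F x) @ \oo --> (0 : plane R)].

Definition stable_direction (R : realType) (F : plane R -> plane R)
    (x : plane R) : set (plane R) :=
  [set v | (fun n => 'd (iter n F) x v : plane R) @ \oo --> (0 : plane R)].

(* An orientation of the unstable foliation is a nowhere vanishing continuous
   section [e] of its tangent line field. *)
Definition preserves_unstable_orientation (R : realType)
    (F G : plane R -> plane R) : Prop :=
  exists e : plane R -> plane R,
  [/\ continuous e, forall x, e x != 0, forall x, stable_direction G x (e x) &
      forall x, exists2 t : R, 0 < t & 'd F x (e x) = t *: e (F x)].

Definition curve_length (R : realType) (g : R -> plane R) (a b : R) : \bar R :=
  ereal_sup [set (\sum_(0 <= n < size s)
      enorm (g (nth b (a :: s) n.+1) - g (nth b (a :: s) n)))%:E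
    | s in itv_partition a b].

Definition leaf_dist (R : realType) (G : plane R -> plane R) (a b : plane R) :
    \bar R :=
  ereal_inf [set curve_length g 0 1 | g in
    [set g : R -> plane R | [/\ {within `[0, 1], continuous g}, g 0 = a,
       g 1 = b & forall t, t \in `[0, 1] -> stable_set G a (g t)]]].

(* [mu x] is the conditional measure at [x], for almost every [x] in [D] (namely
   for [x] in [D']), of the normalized restriction of [leb] to [D] with respect
   to the partition of [D] into the sets [W x].  The second argument of
   [mnormalize] is only used for a measure of mass 0 or [+oo]. *)
Definition disintegration (R : realType) (D : set (plane R))
    (W : plane R -> set (plane R)) (mu : plane R -> probability (plane R) R) :
    Prop :=
  exists mD : measurable D,
  let nu := mnormalize (mrestr (@leb R) mD) point in
  (0 < leb D < +oo)%E /\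
  exists D' : set (plane R),
  [/\ [/\ measurable D', D' `<=` D & leb (D `\` D') = 0%E],
      forall A, measurable A ->
        measurable_fun D' ((fun x => mu x A) : plane R -> \bar R),
      forall x, D' x -> (mu x).-negligible (~` W x),
      forall x y, D' x -> D' y -> W x y ->
        forall A, measurable A -> mu x A = mu y A &
      forall A, measurable A -> nu A = (\int[nu]_(x in D') mu x A)%E].

(* Compact box, so of finite volume, with plaques the images of the horizontal
   segments. *)
Definition foliated_box (R : realType) (leaf : plane R -> set (plane R))
    (D : set (plane R)) : Prop :=
  exists phi : plane R -> plane R,
  let Q : set (plane R) := `[0, 1] `*` `[0, 1] in
  [/\ {within Q, continuous phi},
      forall z w, Q z -> Q w -> phi z = phi w -> z = w,
      phi @` Q = D &
      forall s s' t : R, s \in `[0, 1] -> s' \in `[0, 1] -> t \in `[0, 1] ->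
        leaf (phi (s, t)) (phi (s', t))].

(* [g] is the arc-length parametrisation of the arc [I]. *)
Definition normalized_length (R : realType) (I : set (plane R))
    (lam : probability (plane R) R) : Prop :=
  exists (L : R) (g : R -> plane R),
  [/\ 0 < L /\ {within `[0, L], continuous g},
      forall s t, s \in `[0, L] -> t \in `[0, L] -> g s = g t -> s = t,
      g @` `[0, L] = I,
      forall s t, 0 <= s -> s <= t -> t <= L ->
        curve_length g s t = (t - s)%:E &
      forall A, measurable A ->
        lam A = (L^-1%:E * lebesgue_measure (`[0%R, L] `&` g @^-1` A))%E].

(* [Radon_Nikodym] is constantly [-oo] when [nu] is not absolutely continuous
   with respect to [mu]. *)
Definition rn_derivative (R : realType) (nu mu : probability (plane R) R) :
    plane R -> \bar R :=
  Radon_Nikodym (charge_of_finite_measure nu) mu.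

Definition UBD (R : realType) (leaf : plane R -> set (plane R)) : Prop :=
  exists2 C : R, 1 < C &
  forall D, foliated_box leaf D ->
  let plaque x := connected_component (leaf x `&` D) x in
  forall mu, disintegration D plaque mu ->
  {ae @leb R, forall x, D x ->
     exists2 lam, normalized_length (plaque x) lam &
       {ae lam, forall y,
          (C^-1%:E <= rn_derivative (mu x) lam y <= C%:E)%E}}.

(* [q] is the only point of the unstable leaf of [z] on the stable leaf of the
   origin, [G] being the inverse of [F]. *)
Definition unstable_proj (R : realType) (F G : plane R -> plane R)
    (z q : plane R) : Prop :=
  stable_set G z `&` stable_set F 0 = [set q].

Definition is_side (R : realType) (B S : set (plane R)) : Prop :=
  exists2 z, ~ B z & S = connected_component (~` B) z.

(* The closed positive half of the leaves: the base leaf, a null set, is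
   included. *)
Definition strip0 (R : realType) (F G : plane R -> plane R)
    (S : set (plane R)) (delta : R) : set (plane R) :=
  [set y | (stable_set F 0 `|` S) y /\
     exists2 q, unstable_proj F G y q & (leaf_dist G q y <= delta%:E)%E].

Definition strip (R : realType) (F G : plane R -> plane R)
    (S : set (plane R)) (delta : R) (k : nat) : set (plane R) :=
  iter k F @` strip0 F G S delta.

Definition strip_leaf (R : realType) (F G : plane R -> plane R)
    (S : set (plane R)) (delta : R) (k : nat) (x : plane R) : set (plane R) :=
  stable_set G x `&` strip F G S delta k.

Definition strip_box (R : realType) (F G : plane R -> plane R)
    (S : set (plane R)) (delta : R) (k : nat) (Y : set (plane R)) :
    set (plane R) :=
  [set z | strip F G S delta k z /\ exists2 q, unstable_proj F G z q & Y q].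

Definition conditional_family (R : realType) (F G : plane R -> plane R)
    (S : set (plane R)) (delta : R) (k : nat)
    (mu : plane R -> probability (plane R) R) : Prop :=
  forall U : set (plane R), open U ->
  let Y := U `&` stable_set F 0 in
  bounded_set Y -> Y !=set0 ->
  disintegration (strip_box F G S delta k Y) (strip_leaf F G S delta k) mu.

(* Main.v *)
From HB Require Import structures.
Require Import Defs.
From mathcomp Require Import all_boot all_order all_algebra.
From mathcomp Require Import all_classical all_reals all_analysis.
From mathcomp Require Import measurable_realfun ring lra.

Set Implicit Arguments.
Unset Strict Implicit.
Unset Printing Implicit Defensive.

Import Order.TTheory GRing.Theory Num.Theory.
Import numFieldNormedType.Exports.

Local Open Scope classical_set_scope.
Local Open Scope ring_scope.

(* A map [F] with constant Jacobian multiplies areas by a constant factor, so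
   [F^k] carries the disintegration of Lebesgue measure on a strip box of level 0
   to a disintegration of Lebesgue measure on a strip box of level [k], along the
   leaves [W_k]; the factor disappears in the normalization.  Since
   disintegrations are almost surely unique, [mu k x] and the image of
   [mu 0 (F^-k x)] coincide for almost every [x], and the density is 1.

   The area formula is obtained on rectangles by bisection: a rectangle on which
   it fails by a factor contains a quarter on which it fails by the same factor,
   and the resulting nested rectangles shrink to a point where the
   differentiability of [F] and of its inverse is contradicted. *)

(** * Affine changes of variables in the plane *)

(** By uniqueness it suffices to test the scaled pushforward on left-open intervals. A negative [a]
    turns such an interval into a right-open one of the same length, hence the two cases. *)
Lemma lebesgue_measure_affine (R : realType) (a c : R) (A : set R) :
  a != 0 -> measurable A ->
  (`|a|%:E * lebesgue_measure
     ((fun x : measurableTypeR R => (a * x + c)%R : measurableTypeR R) @^-1` A) =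
   lebesgue_measure A)%E.
Proof.
move=> a0 mA; pose h (x : measurableTypeR R) : measurableTypeR R := a * x + c.
have mh : measurable_fun setT h.
  by apply: measurable_funD => //; apply: measurable_funM.
pose H : {mfun measurableTypeR R >-> measurableTypeR R} :=
  HB.pack h (isMeasurableFun.Build _ _ _ _ h mh).
have a_ge0 : 0 <= `|a| by [].
apply/esym.
rewrite (lebesgue_measure_unique
  (mu := mscale (NngNum a_ge0) (pushforward lebesgue_measure H)))//.
move=> _ [[p q] _ <-]/=; rewrite /mscale/= /pushforward lebesgue_measure_itv/=.
have [an|ap|/eqP] := ltgtP a 0; last by rewrite (negbTE a0).
- have -> : h @^-1` `]p, q] = `[(q - c) / a, (p - c) / a[%classic.
    apply/seteqP; split => x /=; rewrite /h !in_itv/= => /andP[h1 h2].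
      by rewrite ler_ndivrMr// ltr_ndivlMr//; apply/andP; split; lra.
    move: h1 h2; rewrite ler_ndivrMr// ltr_ndivlMr// => h1 h2.
    by apply/andP; split; lra.
  rewrite lebesgue_measure_itv/= !lte_fin ltr_nM2r ?invr_lt0// ltrD2r.
  case: ifP => _; rewrite ?mule0// -!EFinB -EFinM ltr0_norm//.
  by congr EFin; field.
- have -> : h @^-1` `]p, q] = `](p - c) / a, (q - c) / a]%classic.
    apply/seteqP; split => x /=; rewrite /h !in_itv/= => /andP[h1 h2].
      by rewrite ler_pdivlMr// ltr_pdivrMr//; apply/andP; split; lra.
    move: h1 h2; rewrite ler_pdivlMr// ltr_pdivrMr// => h1 h2.
    by apply/andP; split; lra.
  rewrite lebesgue_measure_itv/= !lte_fin ltr_pM2r ?invr_gt0// ltrD2r.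
  case: ifP => _; rewrite ?mule0// -!EFinB -EFinM gtr0_norm//.
  by congr EFin; field.
Qed.

Definition affine (R : realType) (a b c d u v : R) (z : plane R) : plane R :=
  (a * z.1 + b * z.2 + u, c * z.1 + d * z.2 + v).

Lemma measurable_affine (R : realType) (a b c d u v : R) :
  measurable_fun setT (@affine R a b c d u v).
Proof.
apply/measurable_fun_pairP; split.
  apply: (@measurable_funD _ _ R setT
    (fun z : plane R => a * z.1 + b * z.2) (cst u)) => //.
  by apply: measurable_funD; apply: measurable_funM.
apply: (@measurable_funD _ _ R setT
  (fun z : plane R => c * z.1 + d * z.2) (cst v)) => //.
by apply: measurable_funD; apply: measurable_funM.
Qed.

Lemma measurable_affine_preimage (R : realType) (a b c d u v : R)
    (A : set (plane R)) :
  measurable A -> measurable (affine a b c d u v @^-1` A).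
Proof. by move=> mA; rewrite -[X in measurable X]setTI; exact: measurable_affine. Qed.

(** By Fubini: on the vertical section at [x] the map is one-dimensional and affine, with slope [d]
    and translation part [c * x + v]. *)
Lemma leb_affine_snd (R : realType) (c d v : R) (A : set (plane R)) :
  d != 0 -> measurable A ->
  (`|d|%:E * leb (affine 1 0 c d 0 v @^-1` A) = leb A)%E.
Proof.
move=> d0 mA; have mTA := measurable_affine_preimage 1 0 c d 0 v mA.
rewrite /leb /product_measure1 -ge0_integralZl//=.
- apply: eq_integral => x _ /=.
  rewrite -[RHS](@lebesgue_measure_affine _ d (c * x + v))//; last first.
    exact: measurable_xsection.
  congr (_ * lebesgue_measure _)%E; apply/seteqP; split => y /=;
    rewrite /xsection/= !inE/= /affine/= ?mul1r ?mul0r !addr0.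
  + by rewrite addrCA addrA.
  + by rewrite addrCA addrA.
- exact: measurable_fun_xsection.
Qed.

(** The product measure may be integrated in either order; horizontal sections are the ones suited
    to maps that fix the second coordinate. *)
Lemma leb_ysection (R : realType) (A : set (plane R)) : measurable A ->
  leb A = (\int[lebesgue_measure]_y lebesgue_measure (ysection A y))%E.
Proof.
move=> mA; rewrite /leb.
rewrite (product_measure_unique
  (m' := (@lebesgue_measure R \x^ @lebesgue_measure R)%E))//.
by move=> B C mB mC; exact: product_measure2E.
Qed.

Lemma leb_affine_fst (R : realType) (a b u : R) (A : set (plane R)) :
  a != 0 -> measurable A ->
  (`|a|%:E * leb (affine a b 0 1 u 0 @^-1` A) = leb A)%E.
Proof.
move=> a0 mA; have mTA := measurable_affine_preimage a b 0 1 u 0 mA.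
rewrite !leb_ysection// -ge0_integralZl//=.
- apply: eq_integral => y _ /=.
  rewrite -[RHS](@lebesgue_measure_affine _ a (b * y + u))//; last first.
    exact: measurable_ysection.
  congr (_ * lebesgue_measure _)%E; apply/seteqP; split => x /=;
    rewrite /ysection/= !inE/= /affine/= ?mul1r ?mul0r !add0r !addr0 addrA//.
- exact: measurable_fun_ysection.
Qed.

(** Gaussian elimination: with a nonzero pivot the matrix is a lower triangular factor times an
    upper triangular one, and each factor changes a single coordinate. *)
Lemma leb_affine (R : realType) (a b c d u v : R) (A : set (plane R)) :
  a * d - b * c != 0 -> measurable A ->
  (`|a * d - b * c|%:E * leb (affine a b c d u v @^-1` A) = leb A)%E.
Proof.
have pivot (a' b' c' d' : R) B : a' != 0 -> a' * d' - b' * c' != 0 ->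
    measurable B -> (`|a' * d' - b' * c'|%:E *
      leb (affine a' b' c' d' u v @^-1` B) = leb B)%E.
  move=> a0 det0 mB.
  (* The Schur complement of the pivot, which is the lower right entry of the lower triangular
     factor. *)
  pose d1 := d' - b' * c' / a'.
  have d1E : a' * d' - b' * c' = d1 * a' by rewrite /d1; field.
  have d10 : d1 != 0 by apply: contraNneq det0; rewrite d1E => ->; rewrite mul0r.
  pose v1 := v - c' / a' * u.
  have mB1 := measurable_affine_preimage 1 0 (c' / a') d1 0 v1 mB.
  rewrite d1E normrM EFinM -(leb_affine_snd (c' / a') v1 d10 mB).
  rewrite -(leb_affine_fst b' u a0 mB1) muleA -comp_preimage.
  suff -> : affine a' b' c' d' u v =
      affine 1 0 (c' / a') d1 0 v1 \o affine a' b' 0 1 u 0 by [].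
  by apply/funext => z; rewrite /affine/= /d1 /v1; congr pair; field.
move=> det0 mA; have [a0|a0] := eqVneq a 0; last exact: pivot.
have b0 : b != 0 by apply: contraNneq det0 => ->; rewrite a0 !mul0r subr0.
have mTA := measurable_affine_preimage a b c d u v mA.
(* Precomposing with the shear that sends [z] to [(z.1, z.1 + z.2)], of determinant 1, adds the
   second column to the first, so that the pivot becomes [b]. *)
rewrite -[X in (_ * X)%E](@leb_affine_snd _ 1 1 0)// normr1 mul1e.
rewrite (_ : a * d - b * c = b * d - b * (c + d)); last by rewrite a0; ring.
rewrite -[RHS](@pivot b b (c + d) d)//; last first.
  by rewrite (_ : b * d - b * (c + d) = a * d - b * c)// a0; ring.
rewrite -comp_preimage.
suff -> : affine b b (c + d) d u v =
    affine a b c d u v \o affine 1 0 1 1 0 0 by [].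
by apply/funext => z; rewrite /affine/= a0; congr pair; ring.
Qed.

(** * Bisection of rectangles *)

(** [P n a b] is to be read as a property of the rectangle with lower left corner [(a, b)] and sides
    [s / 2 ^+ n] and [t / 2 ^+ n]. A failure at level 0 would descend through quarters to a point
    that contradicts the local hypothesis. *)
Lemma bisection_ind (R : realType) (s t : R) (P : nat -> R -> R -> Prop) :
  0 < s -> 0 < t ->
  (forall n a b, P n.+1 a b -> P n.+1 (a + s / 2 ^+ n.+1) b ->
     P n.+1 a (b + t / 2 ^+ n.+1) ->
     P n.+1 (a + s / 2 ^+ n.+1) (b + t / 2 ^+ n.+1) -> P n a b) ->
  (forall x y, exists m, forall n a b, (m <= n)%N ->
     a <= x <= a + s / 2 ^+ n -> b <= y <= b + t / 2 ^+ n -> P n a b) ->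
  forall a b, P 0%N a b.
Proof.
move=> s0 t0 Pquarter Plocal a0 b0; apply: contrapT => nP0.
have p2 n : 0 < 2 ^+ n :> R by rewrite exprn_gt0.
have half (r : R) n : r / 2 ^+ n.+1 + r / 2 ^+ n.+1 = r / 2 ^+ n.
  by rewrite exprS; field; rewrite gt_eqF.
(* Failing rectangles form a type, so that choice yields a map from each of them to a failing
   quarter, which can be iterated. *)
pose T := {nab : nat * R * R | ~ P nab.1.1 nab.1.2 nab.2}.
pose sub (p q : T) := [/\ (sval q).1.1 = (sval p).1.1.+1,
  (sval p).1.2 <= (sval q).1.2 <=
    (sval p).1.2 + s / 2 ^+ (sval p).1.1.+1 &
  (sval p).2 <= (sval q).2 <= (sval p).2 + t / 2 ^+ (sval p).1.1.+1].
have step (p : T) : exists q, sub p q.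
  case: p => -[[n a] b] /= nP; apply: contrapT => nex; apply: (nP).
  have sn : 0 <= s / 2 ^+ n.+1 by rewrite divr_ge0 ?ltW.
  have tn : 0 <= t / 2 ^+ n.+1 by rewrite divr_ge0 ?ltW.
  apply: Pquarter; apply: contrapT => nP1; apply: nex;
    by exists (exist _ (_, _, _) nP1); split => //=; rewrite ?lexx ?lerDl ?sn ?tn.
have [nxt nxtP] := choice step.
pose u n := iter n nxt (exist _ (0%N, a0, b0) nP0 : T).
have uS n : sub (u n) (u n.+1) by exact: nxtP.
have un n : (sval (u n)).1.1 = n.
  by elim: n => // n IH; have [-> _ _] := uS n; rewrite IH.
pose x n := (sval (u n)).1.2; pose y n := (sval (u n)).2.
have xS n : x n <= x n.+1 <= x n + s / 2 ^+ n.+1.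
  by have [_ + _] := uS n; rewrite un.
have yS n : y n <= y n.+1 <= y n + t / 2 ^+ n.+1.
  by have [_ _] := uS n; rewrite un.
(* In each coordinate the left ends increase and the right ends decrease, so the supremum of the
   left ends lies in every interval. *)
have squeeze (z : nat -> R) (r : R) : 0 < r ->
    (forall n, z n <= z n.+1 <= z n + r / 2 ^+ n.+1) ->
    exists l, forall n, z n <= l <= z n + r / 2 ^+ n.
  move=> r0 zS.
  have zmon n k : z n <= z (n + k)%N.
    elim: k => [|k IH]; rewrite ?addn0// addnS (le_trans IH)//.
    by have /andP[] := zS (n + k)%N.
  have zdec n k : z (n + k)%N + r / 2 ^+ (n + k) <= z n + r / 2 ^+ n.
    elim: k => [|k IH]; rewrite ?addn0// addnS; apply: le_trans IH.
    rewrite -(half r (n + k)%N) addrA lerD2r.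
    by have /andP[] := zS (n + k)%N.
  have zle n m : z m <= z n + r / 2 ^+ n.
    have pos k : 0 <= r / 2 ^+ k by rewrite divr_ge0 ?ltW.
    have [mn|/ltnW nm] := leqP m n.
      rewrite -(subnKC mn); apply: (le_trans (zmon m (n - m)%N)).
      by rewrite lerDl.
    rewrite -(subnKC nm); apply: le_trans (zdec n (m - n)%N).
    by rewrite lerDl.
  exists (sup (range z)) => n; apply/andP; split.
    apply: ub_le_sup; last by exists n.
    by exists (z 0%N + r / 2 ^+ 0) => _ [m _ <-].
  by apply: ge_sup => [|_ [m _ <-] //]; exists (z 0%N), 0%N.
have [lx lxP] := squeeze x s s0 xS; have [ly lyP] := squeeze y t t0 yS.
have [m mP] := Plocal lx ly.
have := svalP (u m); rewrite un; apply.
by apply: mP; [|exact: lxP|exact: lyP].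
Qed.

(** Half-open sides make the four quarters of a rectangle disjoint, so that measures add exactly. *)
Definition rect (R : realType) (a b s t : R) : set (plane R) :=
  `]a, a + s] `*` `]b, b + t].

Lemma measurable_rect (R : realType) (a b s t : R) : measurable (@rect R a b s t).
Proof. by apply: measurableX. Qed.

Lemma leb_rect (R : realType) (a b s t : R) : 0 <= s -> 0 <= t ->
  leb (rect a b s t) = (s * t)%:E.
Proof.
move=> s0 t0; rewrite /leb /rect product_measure1E//=.
have itvE (x r : R) : 0 <= r -> lebesgue_measure `]x, (x + r)%R] = r%:E.
  move=> r0; rewrite lebesgue_measure_itv/= lte_fin ltrDl -EFinB addrAC subrr add0r.
  by case: ltgtP r0 => // <-.
by rewrite !itvE.
Qed.

Lemma rect_quarter (R : realType) (N : {measure set (plane R) -> \bar R})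
    (a b s t : R) : 0 <= s -> 0 <= t ->
  N (rect a b (s + s) (t + t)) =
    (N (rect a b s t) + N (rect (a + s)%R b s t) +
     (N (rect a (b + t)%R s t) + N (rect (a + s)%R (b + t)%R s t)))%E.
Proof.
move=> s0 t0.
have split1 (A : set R) : measurable A -> N (`]a, a + (s + s)] `*` A) =
    (N (`]a, (a + s)%R] `*` A) + N (`](a + s)%R, (a + s + s)%R] `*` A))%E.
  move=> mA; rewrite -measureU//; [|exact: measurableX..|]; last first.
    apply/seteqP; split => // -[x y] [] /= [].
    by rewrite !in_itv/= => /andP[_ +] _ [/andP[+ _] _] => /le_lt_trans/[apply]; rewrite ltxx.
  congr (N _); apply/seteqP; split => -[x y] /=.
    rewrite !in_itv/= => -[/andP[ax xa] Ay].
    by have [xs|xs] := leP x (a + s); [left|right]; rewrite ?ax//= -addrA xa.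
  rewrite !in_itv/= => -[[/andP[ax xa] Ay]|[/andP[ax xa] Ay]]; split => //.
    by rewrite ax/= (le_trans xa)// lerD2l lerDl.
  by rewrite addrA xa andbT (le_lt_trans _ ax)// lerDl.
have split2 (A : set R) : measurable A -> N (A `*` `]b, b + (t + t)]) =
    (N (A `*` `]b, (b + t)%R]) + N (A `*` `](b + t)%R, (b + t + t)%R]))%E.
  move=> mA; rewrite -measureU//; [|exact: measurableX..|]; last first.
    apply/seteqP; split => // -[x y] [] /= [].
    by rewrite !in_itv/= => _ /andP[_ +] [_ /andP[+ _]] => /le_lt_trans/[apply]; rewrite ltxx.
  congr (N _); apply/seteqP; split => -[x y] /=.
    rewrite !in_itv/= => -[Ax /andP[ax xa]].
    by have [xs|xs] := leP y (b + t); [left|right]; rewrite ?ax//= -addrA xa.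
  rewrite !in_itv/= => -[[Ay /andP[ax xa]]|[Ay /andP[ax xa]]]; split => //.
    by rewrite ax/= (le_trans xa)// lerD2l lerDl.
  by rewrite addrA xa andbT (le_lt_trans _ ax)// lerDl.
by rewrite /rect split2//= split1// split1.
Qed.

(** For a fixed [e] the two-sided bound is additive over quarters, so bisection carries it from
    small rectangles to the whole one; then [e] tends to 0. *)
Lemma rect_bound_of_local (R : realType) (N : {measure set (plane R) -> \bar R})
    (J s t : R) : 0 < s -> 0 < t ->
  (forall (e : R) (x y : R), 0 < e -> exists m, forall n a b, (m <= n)%N ->
     a <= x <= a + s / 2 ^+ n -> b <= y <= b + t / 2 ^+ n ->
     (((J - e) * (s / 2 ^+ n * (t / 2 ^+ n)))%:E <=
        N (rect a b (s / 2 ^+ n) (t / 2 ^+ n)) <=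
      ((J + e) * (s / 2 ^+ n * (t / 2 ^+ n)))%:E)%E) ->
  forall a b, N (rect a b s t) = (J * (s * t))%:E.
Proof.
move=> s0 t0 Nloc a b.
have p2 n : 0 < 2 ^+ n :> R by rewrite exprn_gt0.
have half (r : R) n : r / 2 ^+ n = r / 2 ^+ n.+1 + r / 2 ^+ n.+1.
  by rewrite exprS; field; rewrite gt_eqF.
have st0 : 0 < s * t by rewrite mulr_gt0.
suff Nbound e : 0 < e ->
    (((J - e) * (s * t))%:E <= N (rect a b s t) <= ((J + e) * (s * t))%:E)%E.
  have Nfin : N (rect a b s t) \is a fin_num.
    have /andP[h1 h2] := Nbound 1 ltr01.
    by rewrite fin_numElt (lt_le_trans (ltNyr _) h1) (le_lt_trans h2 (ltry _)).
  rewrite -(fineK Nfin); congr EFin; apply/eqP; rewrite -subr_eq0 -normr_le0.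
  apply/ler_addgt0Pl => e e0; rewrite addr0.
  (* Dividing by the area turns the error on the density into an error [e] on the measure. *)
  have := Nbound (e / (s * t)); rewrite divr_gt0// => /(_ isT).
  rewrite -(fineK Nfin) !lee_fin mulrBl mulrDl divfK ?gt_eqF// => /andP[h1 h2].
  by rewrite ler_norml; apply/andP; split; lra.
move=> e0.
pose P n a b : Prop := (((J - e) * (s / 2 ^+ n * (t / 2 ^+ n)))%:E <=
  N (rect a b (s / 2 ^+ n) (t / 2 ^+ n)) <=
  ((J + e) * (s / 2 ^+ n * (t / 2 ^+ n)))%:E)%E.
suff : P 0%N a b by rewrite /P !expr0 !divr1.
apply: (@bisection_ind R s t P) => // [n a' b'|x y]; last first.
  exact: Nloc.
rewrite /P => /andP[l1 u1] /andP[l2 u2] /andP[l3 u3] /andP[l4 u4].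
rewrite (half s) (half t) rect_quarter; [|by rewrite divr_ge0// ltW..].
have quad (c S T : R) : (c * ((S + S) * (T + T)))%:E =
    ((c * (S * T))%:E + (c * (S * T))%:E + ((c * (S * T))%:E + (c * (S * T))%:E))%E.
  by rewrite -!EFinD; congr EFin; ring.
by rewrite !quad; apply/andP; split; do 2 apply: leeD => //.
Qed.

(** * Differentiability and linear bounds in normed spaces *)

Lemma near_eq_differentiable (R : realType) (V W : normedModType R)
    (f g : V -> W) (x : V) :
  (\forall y \near x, f y = g y) -> differentiable f x ->
  differentiable g x.
Proof.
move=> fg df.
have [dfc dfE] := (@diff_locallyP _ _ _ x f).1 df.
have gE : g \o shift x = cst (g x) + 'd f x +o_ 0 id.
  apply/eqaddoP => e e0.
  have /eqaddoP/(_ e e0) dfe := dfE.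
  have fg0 : \forall h \near 0, f (h + x) = g (h + x).
    by move: fg; rewrite (near_shift 0) subr0.
  near=> h.
  have : `|(f \o shift x - (cst (f x) + 'd f x)) h| <= e * `|h| by near: h.
  have fgh : f (h + x) = g (h + x) by near: h.
  by rewrite /= !fctE /= fgh (nbhs_singleton fg).
have dgE : 'd g x = 'd f x :> (V -> W) by exact: diff_unique.
apply/diff_locallyP; split; first by rewrite dgE.
by rewrite dgE.
Unshelve. all: by end_near.
Qed.

Lemma diff_expansion (R : realType) (V W : normedModType R) (f : V -> W)
    (x : V) (e : R) : differentiable f x -> 0 < e ->
  exists2 d : R, 0 < d &
    forall h, `|h| < d -> `|f (x + h) - f x - 'd f x h| <= e * `|h|.
Proof.
move=> /diff_locallyP[_ /eqaddoP/(_ e)] + e0 => /(_ e0) /nbhs_ballP[d /= d0 dP].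
exists d => // h hd; have := dP h; rewrite -ball_normE/= sub0r normrN => /(_ hd).
by rewrite !fctE/= opprD addrA (addrC h).
Qed.

Lemma linear_bound (R : realType) (V W : normedModType R)
    (L : {linear V -> W}) : continuous L ->
  exists2 C : R, 0 < C & forall v, `|L v| <= C * `|v|.
Proof.
move=> /linear_bounded_continuous/linear_boundedP [M [_ MP]].
have m0 : M < `|M| + 1 by rewrite (le_lt_trans (ler_norm _))// ltrDl.
by exists (`|M| + 1); [rewrite ltr_wpDl|exact: MP].
Qed.

(** * Area distortion of a diffeomorphism *)

Lemma plane_norm_le (R : realType) (v : plane R) (c : R) :
  (`|v| <= c) = (`|v.1| <= c) && (`|v.2| <= c).
Proof. by rewrite prod_normE ge_max. Qed.

Lemma linear_planeE (R : realType) (L : {linear plane R -> plane R})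
    (v : plane R) :
  L v = (v.1 * (L (1, 0)).1 + v.2 * (L (0, 1)).1,
         v.1 * (L (1, 0)).2 + v.2 * (L (0, 1)).2).
Proof.
have vE : v = v.1 *: ((1, 0) : plane R) + v.2 *: ((0, 1) : plane R).
  rewrite [LHS]surjective_pairing; congr pair => /=.
    by transitivity (v.1 * 1 + v.2 * 0); [rewrite mulr1 mulr0 addr0|].
  by transitivity (v.1 * 0 + v.2 * 1); [rewrite mulr1 mulr0 add0r|].
by rewrite [in LHS]vE linearD !linearZ.
Qed.

(** The determinant in the standard basis, written like [jacobian] so that the two are convertible
    when [L] is the differential. *)
Definition ldet (R : realType) (L : plane R -> plane R) : R :=
  (L (1, 0)).1 * (L (0, 1)).2 - (L (0, 1)).1 * (L (1, 0)).2.

Lemma ldet_inverse (R : realType) (L M : {linear plane R -> plane R}) :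
  cancel L M -> ldet M * ldet L = 1.
Proof.
move=> LK.
have := LK (1, 0); have := LK (0, 1).
rewrite (linear_planeE M (L (0, 1))) (linear_planeE M (L (1, 0))).
rewrite /ldet; case: (L (1, 0)) => l1 l2; case: (L (0, 1)) => l3 l4 /=.
case: (M (1, 0)) => m1 m2; case: (M (0, 1)) => m3 m4 /=.
move=> [h1 h2] [h3 h4].
transitivity ((l1 * m1 + l2 * m3) * (l3 * m2 + l4 * m4) -
  (l3 * m1 + l4 * m3) * (l1 * m2 + l2 * m4)); first by ring.
by rewrite h1 h2 h3 h4; ring.
Qed.

(** The set is the image of [A] under [L] followed by the translation by [z0]. Taking a preimage
    under [M] divides areas by the determinant of [M], which is the inverse of that of [L]. *)
Lemma leb_linear_preimage (R : realType) (L M : {linear plane R -> plane R})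
    (z0 : plane R) (A : set (plane R)) : cancel L M -> measurable A ->
  leb ((fun z => M (z - z0)) @^-1` A) = (`|ldet L|%:E * leb A)%E.
Proof.
move=> LK mA; have ML := ldet_inverse LK.
have M0 : ldet M != 0.
  by apply/eqP => M0; move: ML; rewrite M0 mul0r => /eqP; rewrite eq_sym oner_eq0.
set m1 := (M (1, 0)).1; set m2 := (M (0, 1)).1.
set m3 := (M (1, 0)).2; set m4 := (M (0, 1)).2.
have -> : (fun z => M (z - z0)) = affine m1 m2 m3 m4
    (- (z0.1 * m1 + z0.2 * m2)) (- (z0.1 * m3 + z0.2 * m4)).
  by apply/funext => z; rewrite linear_planeE /affine/=; congr pair; ring.
rewrite -[in RHS](@leb_affine R m1 m2 m3 m4 (- (z0.1 * m1 + z0.2 * m2))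
  (- (z0.1 * m3 + z0.2 * m4)) A)//.
by rewrite muleA -EFinM -normrM [_ * (_ - _)]mulrC ML normr1 mul1e.
Qed.

Lemma margin_exists (R : realType) (J e s t : R) :
  0 <= J -> 0 < e -> 0 < s -> 0 < t ->
  exists eta : R, [/\ 0 < eta, 2 * eta <= s, 2 * eta <= t,
    J * ((s + 2 * eta) * (t + 2 * eta)) <= (J + e) * (s * t) &
    (J - e) * (s * t) <= J * ((s - 2 * eta) * (t - 2 * eta))].
Proof.
move=> J0 e0 s0 t0.
(* For [eta <= 1], changing both sides by [2 * eta] changes the area by at most
   [eta * (2 * (s + t) + 4)]. The summand 1 keeps [K] positive when [J] is 0. *)
pose K := J * (2 * (s + t) + 4) + 1.
have K0 : 0 < K by rewrite /K ltr_wpDl// mulr_ge0// addr_ge0// mulr_ge0// addr_ge0// ltW.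
have est0 : 0 < e * (s * t) by rewrite !mulr_gt0.
pose eta := Num.min (Num.min 1 (s / 2)) (Num.min (t / 2) (e * (s * t) / K)).
have eta0 : 0 < eta by rewrite !lt_min ltr01 !divr_gt0.
have eta1 : eta <= 1 by rewrite !ge_min lexx.
have etas : eta <= s / 2 by rewrite !ge_min lexx orbT.
have etat : eta <= t / 2 by rewrite !ge_min lexx !orbT.
have etaK : eta <= e * (s * t) / K by rewrite !ge_min lexx !orbT.
have etaJ : eta * J * (2 * (s + t) + 4) <= e * (s * t).
  move: etaK; rewrite ler_pdivlMr// /K mulrDr mulr1 mulrA; lra.
have Je : 0 <= J * eta by rewrite mulr_ge0// ltW.
have Jee : J * eta * eta <= J * eta by rewrite ler_piMr.
have Jee0 : 0 <= J * eta * eta by rewrite mulr_ge0// ltW.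
by exists eta; split => //; [lra|lra|nra|nra].
Qed.

Lemma rescale_error (R : realType) (eta C r q v : R) :
  0 < eta -> 0 < C -> 0 < r -> v <= C * (r * q) -> eta / (C * r) * v <= eta * q.
Proof.
move=> eta0 C0 r0 vq; rewrite mulrAC ler_pdivrMr ?mulr_gt0//.
by rewrite -mulrA ler_pM2l// (_ : q * (C * r) = C * (r * q))//; ring.
Qed.

(** In this lemma and the next, [w] is the linear approximation of [y - x] and [d] bounds its error;
    in the max norm this moves each side of a rectangle by at most [d]. *)
Lemma rect_shrink (R : realType) (x w y : plane R) (a b S T d : R) :
  rect (a - x.1 + d) (b - x.2 + d) (S - 2 * d) (T - 2 * d) w ->
  `|y - x - w| <= d -> rect a b S T y.
Proof.
rewrite /rect/= !in_itv/= => -[/andP[w1 w1'] /andP[w2 w2']].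
rewrite plane_norm_le !ler_norml /= => /andP[/andP[g1 g1'] /andP[g2 g2']].
by split; apply/andP; split; lra.
Qed.

Lemma rect_expand (R : realType) (x w y : plane R) (a b S T d : R) :
  rect a b S T y -> `|w - (y - x)| <= d ->
  rect (a - x.1 - d) (b - x.2 - d) (S + 2 * d) (T + 2 * d) w.
Proof.
rewrite /rect/= !in_itv/= => -[/andP[w1 w1'] /andP[w2 w2']].
rewrite plane_norm_le !ler_norml /= => /andP[/andP[g1 g1'] /andP[g2 g2']].
by split; apply/andP; split; lra.
Qed.

Lemma rect_norm (R : realType) (x y : plane R) (a b S T : R) :
  0 <= S -> 0 <= T -> a <= x.1 <= a + S -> b <= x.2 <= b + T ->
  rect a b S T y -> `|y - x| <= S + T.
Proof.
move=> S0 T0 /andP[ax xa] /andP[bx xb].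
rewrite /rect/= !in_itv/= => -[/andP[w1 w1'] /andP[w2 w2']].
rewrite plane_norm_le !ler_norml /=.
by apply/andP; split; apply/andP; split; lra.
Qed.

Lemma rect_shrink_norm (R : realType) (x w : plane R) (a b S T d : R) :
  0 <= S -> 0 <= T -> 0 <= d -> a <= x.1 <= a + S -> b <= x.2 <= b + T ->
  rect (a - x.1 + d) (b - x.2 + d) (S - 2 * d) (T - 2 * d) w ->
  `|w| <= S + T.
Proof.
move=> S0 T0 d0 /andP[ax xa] /andP[bx xb].
rewrite /rect/= !in_itv/= => -[/andP[w1 w1'] /andP[w2 w2']].
rewrite plane_norm_le !ler_norml /=.
by apply/andP; split; apply/andP; split; lra.
Qed.

(** The preimage of a small rectangle around [x] is squeezed between two parallelograms, the affine
    images of the rectangle with margins of relative size [eta]. The inner inclusion uses the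
    expansion of [G] at [F x], the outer one that of [F] at [x]: in each case the rectangle bounds
    the increment. *)
Lemma local_volume_bounds (R : realType) (F G : plane R -> plane R)
    (x : plane R) (s t e : R) :
  cancel F G -> cancel G F -> differentiable F x -> differentiable G (F x) ->
  0 < s -> 0 < t -> 0 < e -> continuous G ->
  exists m, forall n a b, (m <= n)%N ->
    a <= x.1 <= a + s / 2 ^+ n -> b <= x.2 <= b + t / 2 ^+ n ->
    (((`|Defs.jacobian F x| - e) * (s / 2 ^+ n * (t / 2 ^+ n)))%:E <=
       leb (G @^-1` rect a b (s / 2 ^+ n) (t / 2 ^+ n)) <=
     ((`|Defs.jacobian F x| + e) * (s / 2 ^+ n * (t / 2 ^+ n)))%:E)%E.
Proof.
move=> FK GK dF dG s0 t0 e0 cG.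
pose L : {linear plane R -> plane R} := 'd F x.
pose M : {linear plane R -> plane R} := 'd G (F x).
have MLid : M \o L = id :> (plane R -> plane R).
  rewrite -(diff_comp dF dG) (_ : G \o F = id); last exact/funext.
  by rewrite (@diff_lin _ _ _ idfun)// => y; exact: cvg_id.
have LK : cancel L M by move=> v; exact: (congr1 (@^~ v) MLid).
have MK : cancel M L.
  have dF' : differentiable F (G (F x)) by rewrite FK.
  have LMid : 'd F (G (F x)) \o M = id :> (plane R -> plane R).
    rewrite -(diff_comp dG dF') (_ : F \o G = id); last exact/funext.
    by rewrite (@diff_lin _ _ _ idfun)// => y; exact: cvg_id.
  by move=> v; have := congr1 (@^~ v) LMid; rewrite (FK x).
set J := `|Defs.jacobian F x|.
have JE : `|ldet L| = J by [].
have [eta [eta0 etas etat Jup Jlo]] := @margin_exists R J e s t (normr_ge0 _) e0 s0 t0.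
have [CM CM0 CMP] := linear_bound (diff_continuous dG : continuous M).
have [CL CL0 CLP] := linear_bound (diff_continuous dF : continuous L).
have r0 : 0 < s + t by rewrite addr_gt0.
(* At level [n] increments are at most [(s + t) / 2 ^+ n], up to the bound of the linear map; these
   accuracies make the final error at most [eta / 2 ^+ n]. *)
have e10 : 0 < eta / (CM * (s + t)) by rewrite divr_gt0// mulr_gt0.
have e20 : 0 < eta / (CL * (s + t)) by rewrite divr_gt0// mulr_gt0.
have [d1 d10 d1P] := diff_expansion dF e10.
have [d2 d20 d2P] := diff_expansion dG e20.
have Gexp w : `|L w| < d2 ->
    `|G (F x + L w) - x - w| <= eta / (CL * (s + t)) * `|L w|.
  by move=> /d2P; rewrite [G (F x)]FK [X in _ - X](LK w : 'd G (F x) (L w) = w).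
have Fexp z : `|G z - x| < d1 ->
    `|z - F x - L (G z - x)| <= eta / (CM * (s + t)) * `|G z - x|.
  move=> /d1P; rewrite [F (x + _)](_ : _ = z)//.
  by rewrite [x + _]addrC subrK; exact: GK.
have [m mP] : exists m, forall n, (m <= n)%N ->
    (s + t) / 2 ^+ n < d1 /\ CL * ((s + t) / 2 ^+ n) < d2.
  (* Each summand is one of the two thresholds that [2 ^+ n] has to exceed. *)
  pose K := (s + t) / d1 + CL * (s + t) / d2.
  have K1 : 0 <= (s + t) / d1 by rewrite divr_ge0 ?ltW.
  have K2 : 0 <= CL * (s + t) / d2 by rewrite divr_ge0 ?mulr_ge0 ?ltW.
  exists (Num.truncn K).+1 => n mn.
  have Kn : K < 2 ^+ n.
    apply: (@lt_le_trans _ _ n%:R).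
      by rewrite (lt_le_trans (truncnS_gt K))// ler_nat.
    by rewrite -natrX ler_nat ltnW// ltn_expl.
  have p2 : 0 < 2 ^+ n :> R by rewrite exprn_gt0.
  split.
    rewrite ltr_pdivrMr// mulrC -ltr_pdivrMr// (le_lt_trans _ Kn)//.
    by rewrite /K lerDl.
  rewrite mulrA ltr_pdivrMr// [ltRHS]mulrC -ltr_pdivrMr// (le_lt_trans _ Kn)//.
  by rewrite /K lerDr.
exists m => n a b mn xab xcd.
have [rd1 rd2] := mP n mn.
have p2 : 0 < 2 ^+ n :> R by rewrite exprn_gt0.
set q := (2 ^+ n)^-1 in xab xcd rd1 rd2 *.
have q0 : 0 < q by rewrite invr_gt0.
have sq0 : 0 < s * q by rewrite mulr_gt0.
have tq0 : 0 < t * q by rewrite mulr_gt0.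
have eq0 : 0 < eta * q by rewrite mulr_gt0.
have mG A : measurable A -> measurable (G @^-1` A).
  by move=> mA; rewrite -[X in measurable X]setTI; exact: continuous_plane_measurable.
have mT A : measurable A -> measurable ((fun z => M (z - F x)) @^-1` A).
  move=> mA; rewrite -[X in measurable X]setTI.
  apply: continuous_plane_measurable => // z.
  apply: (@continuous_comp _ _ _ (fun z => z - F x) M).
    by apply: cvgB; [exact: cvg_id|exact: cvg_cst].
  exact: (diff_continuous dG).
apply/andP; split.
- apply: (@le_trans _ _ (leb ((fun z => M (z - F x)) @^-1`
    rect (a - x.1 + eta * q) (b - x.2 + eta * q)
         (s * q - 2 * (eta * q)) (t * q - 2 * (eta * q))))).
    rewrite (leb_linear_preimage (F x) LK) ?JE//; last exact: measurable_rect.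
    rewrite leb_rect; last 2 first.
    + by rewrite mulrA -mulrBl mulr_ge0 ?subr_ge0// ltW.
    + by rewrite mulrA -mulrBl mulr_ge0 ?subr_ge0// ltW.
    rewrite -EFinM lee_fin.
    rewrite [leLHS](_ : _ = (J - e) * (s * t) * (q * q)); last by ring.
    rewrite [leRHS](_ : _ = J * ((s - 2 * eta) * (t - 2 * eta)) * (q * q)); last by ring.
    by rewrite ler_pM2r// mulr_gt0.
  apply: le_measure; rewrite ?inE.
  + by apply: mT; exact: measurable_rect.
  + by apply: mG; exact: measurable_rect.
  suff main w : rect (a - x.1 + eta * q) (b - x.2 + eta * q)
      (s * q - 2 * (eta * q)) (t * q - 2 * (eta * q)) w ->
      rect a b (s * q) (t * q) (G (F x + L w)).
    move=> z /= /main; rewrite (_ : F x + L _ = z)//.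
    by rewrite (MK (z - F x)) addrC subrK.
  move=> wrect; have wr := rect_shrink_norm (ltW sq0) (ltW tq0) (ltW eq0) xab xcd wrect.
  rewrite -mulrDl in wr.
  apply: (rect_shrink wrect).
  have wd2 : `|L w| < d2.
    by apply: le_lt_trans (CLP w) _; apply: le_lt_trans rd2; rewrite ler_pM2l.
  apply: (le_trans (Gexp w wd2)).
  exact: (rescale_error eta0 CL0 r0 (le_trans (CLP w) (ler_wpM2l (ltW CL0) wr))).
- apply: (@le_trans _ _ (leb ((fun z => M (z - F x)) @^-1`
    rect (a - x.1 - eta * q) (b - x.2 - eta * q)
         (s * q + 2 * (eta * q)) (t * q + 2 * (eta * q))))); last first.
    rewrite (leb_linear_preimage (F x) LK) ?JE//; last exact: measurable_rect.
    rewrite leb_rect; last 2 first.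
    + by rewrite addr_ge0 ?mulr_ge0 ?ltW.
    + by rewrite addr_ge0 ?mulr_ge0 ?ltW.
    rewrite -EFinM lee_fin.
    rewrite [leRHS](_ : _ = (J + e) * (s * t) * (q * q)); last by ring.
    rewrite [leLHS](_ : _ = J * ((s + 2 * eta) * (t + 2 * eta)) * (q * q)); last by ring.
    by rewrite ler_pM2r// mulr_gt0.
  apply: le_measure; rewrite ?inE.
  + by apply: mG; exact: measurable_rect.
  + by apply: mT; exact: measurable_rect.
  move=> z /= zrect; have hr := rect_norm (ltW sq0) (ltW tq0) xab xcd zrect.
  rewrite -mulrDl in hr.
  apply: (rect_expand zrect).
  (* The error of the linear model is the image under [M] of the remainder of [F] at the increment
     [G z - x]. *)
  have -> : M (z - F x) - (G z - x) = M (z - F x - L (G z - x)).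
    by rewrite [RHS]linearB [X in _ = _ - X](LK (G z - x)).
  apply: (le_trans (CMP _)).
  apply: (@le_trans _ _ (CM * (eta / (CM * (s + t)) * `|G z - x|))).
    exact: (ler_wpM2l (ltW CM0) (Fexp z (le_lt_trans hr rd1))).
  rewrite mulrCA.
  exact: (rescale_error eta0 CM0 r0 (ler_wpM2l (ltW CM0) hr)).
Qed.

(** * Rational boxes, a countable class that determines measures *)

Definition rat_box (R : realType) (q : (rat * rat) * (rat * rat)) :
    set (plane R) :=
  `]ratr q.1.1, ratr q.1.2] `*` `]ratr q.2.1, ratr q.2.2].

Lemma measurable_rat_box (R : realType) q : measurable (@rat_box R q).
Proof. exact: measurableX. Qed.

(** Boxes with crossed endpoints are empty and count as boxes, so the class is stable under
    intersection without exception. *)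
Lemma rat_box_setI (R : realType) (q r : (rat * rat) * (rat * rat)) :
  @rat_box R q `&` rat_box r =
  rat_box ((Num.max q.1.1 r.1.1, Num.min q.1.2 r.1.2),
           (Num.max q.2.1 r.2.1, Num.min q.2.2 r.2.2)).
Proof.
have itvI (a b c d : rat) : `]ratr a, ratr b] `&` `]ratr c, ratr d] =
    `](ratr (Num.max a c) : R), ratr (Num.min b d)]%classic.
  have -> : ratr (Num.max a c) = Num.max (ratr a) (ratr c) :> R.
    by rewrite !maxEle ler_rat; case: ifP.
  have -> : ratr (Num.min b d) = Num.min (ratr b) (ratr d) :> R.
    by rewrite !minEle ler_rat; case: ifP.
  apply/seteqP; split => x /=; rewrite !in_itv/= gt_max le_min.
    by move=> [/andP[-> ->] /andP[-> ->]].
  by move=> /andP[/andP[-> ->] /andP[-> ->]].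
by rewrite /rat_box -setXI !itvI.
Qed.

Lemma rat_itv_in (R : realType) (l x : R) : l < x ->
  exists p q : rat, [/\ l <= ratr p, ratr p < x & x <= ratr q].
Proof.
move=> lx; have [p] := rat_in_itvoo lx; rewrite in_itv/= => /andP[lp px].
have /rat_in_itvoo[q] : x < x + 1 by rewrite ltrDl.
by rewrite in_itv/= => /andP[/ltW xq _]; exists p, q; split => //; exact: ltW.
Qed.

(** The product sigma-algebra is generated by the two projections, and an open half-plane bounded by
    a vertical or horizontal line is a countable union of rational boxes. *)
Lemma measurable_rat_boxE (R : realType) :
  @measurable _ (plane R) = <<s range (@rat_box R) >>.
Proof.
apply/seteqP; split; last first.
  apply: smallest_sub; first exact: sigma_algebra_measurable.
  by move=> _ [q _ <-]; exact: measurable_rat_box.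
pose T := g_sigma_algebraType (range (@rat_box R)).
have mbox q : @measurable _ T (rat_box q).
  by apply: sub_sigma_algebra; exists q.
have mfst : measurable_fun setT (fst : T -> measurableTypeR R).
  apply: (measurability _ (RGenOInfty.measurableE R)).
  move=> _ [_ [l ->] <-]; rewrite setTI.
  have -> : (fst : T -> R) @^-1` `]l, +oo[ =
      \bigcup_(q in [set q | l <= ratr q.1.1]) rat_box q.
    apply/seteqP; split => [[x y]/=|[x y] [q/= lq [/= + _]]]; rewrite !in_itv/= !andbT.
      move=> lx; have [p1 [p2 [lp px xp]]] := rat_itv_in lx.
      have y1 : y - 1 < y by rewrite ltrBlDr ltrDl.
      have [p3 [p4 [_ py yp]]] := rat_itv_in y1.
      exists ((p1, p2), (p3, p4)) => //.
      by split; rewrite /= in_itv/= ?px ?xp ?py ?yp.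
    by move=> /andP[+ _]; exact: le_lt_trans.
  rewrite bigcup_mkcond; apply: countable_bigcupT_measurable => // q.
  by case: ifP.
have msnd : measurable_fun setT (snd : T -> measurableTypeR R).
  apply: (measurability _ (RGenOInfty.measurableE R)).
  move=> _ [_ [l ->] <-]; rewrite setTI.
  have -> : (snd : T -> R) @^-1` `]l, +oo[ =
      \bigcup_(q in [set q | l <= ratr q.2.1]) rat_box q.
    apply/seteqP; split => [[y x]/=|[y x] [q/= lq [/= _ +]]]; rewrite !in_itv/= !andbT.
      move=> lx; have [p1 [p2 [lp px xp]]] := rat_itv_in lx.
      have y1 : y - 1 < y by rewrite ltrBlDr ltrDl.
      have [p3 [p4 [_ py yp]]] := rat_itv_in y1.
      exists ((p3, p4), (p1, p2)) => //.
      by split; rewrite /= in_itv/= ?px ?xp ?py ?yp.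
    by move=> /andP[+ _]; exact: le_lt_trans.
  rewrite bigcup_mkcond; apply: countable_bigcupT_measurable => // q.
  by case: ifP.
apply: smallest_sub; first exact: smallest_sigma_algebra.
move=> A [] [B mB <-]; first exact: mfst.
exact: msnd.
Qed.

Lemma measure_rat_box_unique (R : realType)
    (m1 m2 : {measure set (plane R) -> \bar R}) :
  (forall q, m1 (rat_box q) = m2 (rat_box q)) ->
  (forall q, (m1 (rat_box q) < +oo)%E) ->
  forall A, measurable A -> m1 A = m2 A.
Proof.
move=> m12 m1fin.
pose g n := @rat_box R ((- n%:R, n%:R), (- n%:R, n%:R)).
apply: (measure_unique (range (@rat_box R)) g).
- exact: measurable_rat_boxE.
- by move=> _ _ [q _ <-] [r _ <-]; rewrite rat_box_setI; eexists.
- by move=> n; eexists.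
- apply/seteqP; split => // -[x y] _.
  pose n := (Num.truncn (`|x| + `|y|)).+1.
  have xyn : `|x| + `|y| < n%:R by exact: truncnS_gt.
  have xn : `|x| < n%:R by rewrite (le_lt_trans _ xyn)// lerDl.
  have yn : `|y| < n%:R by rewrite (le_lt_trans _ xyn)// lerDr.
  exists n => //; split; rewrite /= in_itv/= rmorphN/= ratr_nat.
  + by move: xn; rewrite ltr_norml => /andP[-> /ltW ->].
  + by move: yn; rewrite ltr_norml => /andP[-> /ltW ->].
- by move=> _ [q _ <-].
- by move=> n; exact: m1fin.
Qed.

Lemma rat_box_rect (R : realType) (q : (rat * rat) * (rat * rat)) :
  @rat_box R q = set0 \/
  exists2 st : R * R, 0 < st.1 /\ 0 < st.2 &
    rat_box q = rect (ratr q.1.1) (ratr q.2.1) st.1 st.2.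
Proof.
have [h1|h1] := ltP (ratr q.1.1 : R) (ratr q.1.2); last first.
  left; apply/seteqP; split => // -[x y] [/=]; rewrite in_itv/= => /andP[xl xr].
  by have := lt_le_trans xl (le_trans xr h1); rewrite ltxx.
have [h2|h2] := ltP (ratr q.2.1 : R) (ratr q.2.2); last first.
  left; apply/seteqP; split => // -[x y] [/=] _; rewrite in_itv/= => /andP[xl xr].
  by have := lt_le_trans xl (le_trans xr h2); rewrite ltxx.
right; exists (ratr q.1.2 - ratr q.1.1, ratr q.2.2 - ratr q.2.1).
  by rewrite /= !subr_gt0.
by rewrite /rect /rat_box /= ![_ + (_ - _)]addrC !subrK.
Qed.

(** The pushforward of [leb] under [G] has local density [J] at every point, so bisection identifies
    it with [J] times [leb] on rational boxes, hence everywhere. *)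
Lemma leb_diffeo (R : realType) (F G : plane R -> plane R) (J : R)
    (A : set (plane R)) :
  cancel F G -> cancel G F ->
  (forall x, differentiable F x) -> (forall x, differentiable G x) ->
  (forall x, `|Defs.jacobian F x| = J) -> measurable A ->
  leb (G @^-1` A) = (J%:E * leb A)%E.
Proof.
move=> FK GK dF dG FJ.
have cG : continuous G by move=> z; exact: differentiable_continuous.
have J0 : 0 <= J by rewrite -(FJ 0).
have mG : measurable_fun setT G := continuous_plane_measurable cG.
(* [N_] abstracts over the measurability proof that the measure structure of
   [pushforward] requires. *)
pose N_ : {measure set (plane R) -> \bar R} := pushforward (@leb R) G.
pose N := N_ mG.
have box q : N (rat_box q) = (J%:E * leb (rat_box q))%E.
  have [->|[[s t] /= [s0 t0] ->]] := rat_box_rect R q.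
    by rewrite !measure0 mule0.
  rewrite leb_rect ?ltW// -EFinM.
  apply: (@rect_bound_of_local R N J s t) => // e x y e0.
  have [m mP] := local_volume_bounds FK GK (dF (x, y)) (dG _) s0 t0 e0 cG.
  by exists m => n a b mn xa yb; have := mP n a b mn xa yb; rewrite FJ.
apply: (@measure_rat_box_unique R N (mscale (NngNum J0) (@leb R))) => q.
  by rewrite box.
rewrite box; have [->|[[s t] /= [s0 t0] ->]] := rat_box_rect R q.
  by rewrite measure0 mule0.
by rewrite leb_rect ?ltW// -EFinM ltry.
Qed.

(** Near [z] the global inverse [G] coincides with a local inverse of class C1. *)
Lemma local_C1_diffeo_inverse_differentiable (R : realType)
    (F G : plane R -> plane R) (z : plane R) :
  local_C1_diffeo F -> cancel F G -> cancel G F -> differentiable G z.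
Proof.
move=> FC1 FK GK; have [U [H [[oU Uz] oFU _ HC1 HF]]] := FC1 (G z).
have FUz : (F @` U) z by exists (G z).
apply: (@near_eq_differentiable R _ _ H); last by have [] := HC1 z FUz.
apply: filterS (open_nbhs_nbhs (conj oFU FUz)) => _ [y Uy <-].
by rewrite HF// FK.
Qed.

(** * Uniqueness and transport of disintegrations *)

(** [disintegration] with the normalizing factor cleared and the full-measure set [D'] made
    explicit: in this form a map that scales areas by a constant can transport it. *)
Definition leb_disintegration (R : realType) (D : set (plane R))
    (W : plane R -> set (plane R)) (D' : set (plane R))
    (mu : plane R -> probability (plane R) R) : Prop :=
  [/\ [/\ measurable D', D' `<=` D & leb (D `\` D') = 0%E],
      forall A, measurable A ->
        measurable_fun D' ((fun x => mu x A) : plane R -> \bar R),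
      forall x, D' x -> (mu x).-negligible (~` W x),
      forall x y, D' x -> D' y -> W x y ->
        forall A, measurable A -> mu x A = mu y A &
      forall A, measurable A ->
        leb (A `&` D) = (\int[@leb R]_(x in D') mu x A)%E].

Lemma disintegration_leb (R : realType) (D : set (plane R))
    (W : plane R -> set (plane R)) (mu : plane R -> probability (plane R) R) :
  disintegration D W mu ->
  [/\ measurable D, (leb D < +oo)%E & exists D', leb_disintegration D W D' mu].
Proof.
move=> [mD [/andP[D0 Doo] [D' [[mD' D'D D'0] mmu muW muE nuE]]]].
split => //; exists D'; split => // A mA.
have Dfin : leb D \is a fin_num by rewrite ge0_fin_numE.
have c0 : 0 < fine (leb D) by rewrite fine_gt0// D0 Doo.
have cV0 : 0 <= (fine (leb D))^-1 by rewrite invr_ge0 ltW.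
have nE B : mnormalize (mrestr (@leb R) mD) point B =
    (leb (B `&` D) * ((fine (leb D))^-1)%:E)%E.
  have rT : mrestr (@leb R) mD setT = leb D by rewrite /mrestr setTI.
  by rewrite /mnormalize/= rT gt_eqF// lt_eqF.
have := nuE A mA; rewrite nE.
(* On subsets of [D'] the normalized measure is [leb] divided by [leb D]; this factor then occurs on
   both sides and cancels. *)
rewrite (eq_measure_integral (mscale (NngNum cV0) (@leb R))); last first.
  move=> B mB BD'; rewrite [LHS]nE /mscale/= muleC (setIidl _)//.
  exact: subset_trans BD' D'D.
rewrite ge0_integral_mscale//=; last exact: mmu.
rewrite [RHS]muleC => /(congr1 (fun z => z * (fine (leb D))%:E)%E).
by rewrite -!muleA -!EFinM mulVf ?gt_eqF// !mule1.
Qed.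

Lemma leb_disintegration_restrict (R : realType) (D : set (plane R))
    (W : plane R -> set (plane R)) (D' D0 : set (plane R))
    (mu : plane R -> probability (plane R) R) :
  measurable D -> measurable D0 -> D0 `<=` D' -> leb (D `\` D0) = 0%E ->
  leb_disintegration D W D' mu -> leb_disintegration D W D0 mu.
Proof.
move=> mD mD0 D0D' DD0 [[mD' D'D D'0] mmu muW muE nuE]; split.
- by split => //; exact: subset_trans D0D' D'D.
- by move=> A mA; exact: measurable_funS (mmu A mA).
- by move=> x /D0D'; exact: muW.
- by move=> x y /D0D' D'x /D0D' D'y; exact: muE.
- move=> A mA; rewrite nuE// (@ge0_negligible_integral _ _ _ _ D' (D' `\` D0))//.
  + rewrite (_ : D' `\` (D' `\` D0) = D0)//.
    by rewrite setDD; apply/setIidr.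
  + exact: measurableD.
  + exact: mmu.
  + apply/eqP; rewrite -measure_le0 -DD0; apply: le_measure; rewrite ?inE;
      [exact: measurableD..|exact: setSD].
Qed.

Lemma integrable_probability (R : realType) (E : set (plane R))
    (mu : plane R -> probability (plane R) R) (A : set (plane R)) :
  measurable E -> (leb E < +oo)%E -> measurable A ->
  measurable_fun E ((fun x => mu x A) : plane R -> \bar R) ->
  (@leb R).-integrable E (fun x => mu x A).
Proof.
move=> mE Eoo mA mmu; apply/integrableP; split => //.
apply: (@le_lt_trans _ _ (\int[@leb R]_(x in E) 1)%E); last first.
  by rewrite integral_cst// mul1e.
apply: ge0_le_integral => //; first exact: measurableT_comp.
by move=> x _; rewrite gee0_abs// probability_le1.
Qed.

(* [mu x] charges neither the complement of the block of [x] nor, almost surely,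
   the complement of [D'], so it sees a saturated set [E] as everything or
   nothing. *)
Lemma leb_disintegration_saturated (R : realType) (D : set (plane R))
    (W : plane R -> set (plane R)) (D' : set (plane R))
    (mu : plane R -> probability (plane R) R) (A E : set (plane R)) :
  leb_disintegration D W D' mu -> measurable A -> measurable E -> E `<=` D' ->
  (forall x y, D' x -> D' y -> W x y -> (E x <-> E y)) ->
  leb (A `&` E) = (\int[@leb R]_(x in E) mu x A)%E.
Proof.
move=> [[mD' D'D D'0] mmu muW muE nuE] mA mE ED' satE.
have mnD' : measurable (~` D') by exact: measurableC.
have mAE : measurable (A `&` E) by exact: measurableI.
(* This is the integral formula for the complement of [D'], whose part in [D] is null. *)
have null : ae_eq (@leb R) D' (fun x => mu x (~` D')) (cst 0%E).
  apply/ae_eq_integral_abs => //; first exact: mmu.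
  under eq_integral do rewrite gee0_abs//.
  by rewrite -nuE// setIC -setDE.
have -> : leb (A `&` E) = leb (A `&` E `&` D).
  by congr leb; rewrite [RHS]setIidl// => x [_ /ED'/D'D].
rewrite nuE//.
transitivity (\int[@leb R]_(x in D') ((fun x => mu x A) \_ E) x)%E; last first.
  by rewrite -integral_mkcondr (setIidr ED').
apply: ae_eq_integral => //.
- exact: mmu.
- apply/measurable_restrict => //; rewrite (setIidr ED').
  exact: measurable_funS (mmu A mA).
apply: filterS null => x xnull D'x; have {}xnull := xnull D'x.
have [B [mB B0 WB]] := muW x D'x.
have BW y : ~ B y -> W x y by move=> nBy; apply: contrapT => /WB.
rewrite /patch; case: ifPn => [|/negP]; rewrite inE => Ex.
  apply/eqP; rewrite eq_le; apply/andP; split.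
    by apply: le_measure; rewrite ?inE//; exact: subIsetl.
  have nB : mu x (~` D' `|` B) = 0%E by rewrite measureU0.
  rewrite -(measureU0 mAE (measurableU _ _ mnD' mB) nB).
  apply: le_measure; rewrite ?inE//.
    by apply: measurableU => //; exact: measurableU.
  move=> y Ay; have [By|/BW Wxy] := pselect (B y); first by right; right.
  have [D'y|nD'y] := pselect (D' y); last by right; left.
  by left; split => //; exact: (satE x y D'x D'y Wxy).1.
apply: (subset_measure0 mAE mB) => // y [_ Ey]; apply: contrapT => /BW Wxy.
exact/Ex/(satE x y D'x (ED' _ Ey) Wxy).2.
Qed.

(** The set [E] where the strict inequality holds is saturated, so both families integrate over it
    to [leb (A]&[E)]. Their difference is positive on [E] with integral 0, which forces [E] to be
    null. *)
Lemma leb_disintegration_unique1 (R : realType) (D : set (plane R))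
    (W : plane R -> set (plane R)) (D' : set (plane R))
    (mu1 mu2 : plane R -> probability (plane R) R) (A : set (plane R)) :
  (leb D < +oo)%E -> measurable D -> measurable A ->
  leb_disintegration D W D' mu1 -> leb_disintegration D W D' mu2 ->
  leb (D' `&` [set x | (mu2 x A < mu1 x A)%E]) = 0%E.
Proof.
move=> Doo mD mA dis1 dis2; set E := D' `&` _.
have [[mD' D'D _] mmu1 _ muE1 _] := dis1.
have [_ mmu2 _ muE2 _] := dis2.
have mE : measurable E by exact: measurable_lte (mmu2 A mA) (mmu1 A mA).
have ED' : E `<=` D' by exact: subIsetl.
have satE x y : D' x -> D' y -> W x y -> (E x <-> E y).
  move=> D'x D'y Wxy; rewrite /E /setI/= (muE1 x y)// (muE2 x y)//.
  by split => -[].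
have Eoo : (leb E < +oo)%E.
  by apply: le_lt_trans Doo; apply: le_measure; rewrite ?inE// => x /ED'/D'D.
have i1 : (@leb R).-integrable E (fun x => mu1 x A).
  by apply: integrable_probability => //; exact: measurable_funS (mmu1 A mA).
have i2 : (@leb R).-integrable E (fun x => mu2 x A).
  by apply: integrable_probability => //; exact: measurable_funS (mmu2 A mA).
have fin2 x : mu2 x A \is a fin_num by exact: fin_num_measure.
have : ae_eq (@leb R) E (fun x => mu1 x A - mu2 x A)%E (cst 0%E).
  apply/ae_eq_integral_abs => //.
    by apply: emeasurable_funB; [case/integrableP: i1|case/integrableP: i2].
  transitivity (\int[@leb R]_(x in E) (mu1 x A - mu2 x A))%E.
    apply: eq_integral => x; rewrite inE => -[_ /= lt21].
    by rewrite gee0_abs// sube_ge0 ?ltW// fin2.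
  rewrite integralB//.
  rewrite -(leb_disintegration_saturated dis1 mA mE ED' satE).
  rewrite -(leb_disintegration_saturated dis2 mA mE ED' satE).
  rewrite subee// ge0_fin_numE// (le_lt_trans _ Eoo)//.
  by apply: le_measure; rewrite ?inE//; exact: measurableI.
move=> aeE; suff : (@leb R).-negligible E by move/negligibleP; exact.
apply: negligibleS aeE => x Ex /= /(_ Ex) eq0.
by case: Ex => _ /=; rewrite -sube_gt0 eq0 ltxx.
Qed.

(** Countably many rational boxes leave a single null set outside which the two measures agree on
    all boxes, hence on all measurable sets. *)
Lemma leb_disintegration_unique (R : realType) (D : set (plane R))
    (W : plane R -> set (plane R)) (D1 D2 : set (plane R))
    (mu1 mu2 : plane R -> probability (plane R) R) :
  (leb D < +oo)%E -> measurable D ->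
  leb_disintegration D W D1 mu1 -> leb_disintegration D W D2 mu2 ->
  {ae @leb R, forall x, D x -> forall A, measurable A -> mu1 x A = mu2 x A}.
Proof.
move=> Doo mD dis1 dis2; pose D0 := D1 `&` D2.
have [mD1 D1D D10] : [/\ measurable D1, D1 `<=` D & leb (D `\` D1) = 0%E].
  by case: dis1.
have [mD2 D2D D20] : [/\ measurable D2, D2 `<=` D & leb (D `\` D2) = 0%E].
  by case: dis2.
have mD0 : measurable D0 by exact: measurableI.
have D00 : leb (D `\` D0) = 0%E.
  by rewrite /D0 setDIr measureU0//; exact: measurableD.
have {}dis1 : leb_disintegration D W D0 mu1.
  by apply: leb_disintegration_restrict dis1 => //; exact: subIsetl.
have {}dis2 : leb_disintegration D W D0 mu2.
  by apply: leb_disintegration_restrict dis2 => //; exact: subIsetr.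
pose E1 q := D0 `&` [set x | (mu2 x (rat_box q) < mu1 x (rat_box q))%E].
pose E2 q := D0 `&` [set x | (mu1 x (rat_box q) < mu2 x (rat_box q))%E].
have nE1 q : (@leb R).-negligible (E1 q).
  exists (E1 q); split; [| |exact: subset_refl].
    have [_ m1 _ _ _] := dis1; have [_ m2 _ _ _] := dis2.
    by apply: measurable_lte => //; [apply: m2|apply: m1]; exact: measurable_rat_box.
  by apply: (leb_disintegration_unique1 (D := D) (W := W)) => //;
    exact: measurable_rat_box.
have nE2 q : (@leb R).-negligible (E2 q).
  exists (E2 q); split; [| |exact: subset_refl].
    have [_ m1 _ _ _] := dis1; have [_ m2 _ _ _] := dis2.
    by apply: measurable_lte => //; [apply: m1|apply: m2]; exact: measurable_rat_box.
  by apply: (leb_disintegration_unique1 (D := D) (W := W)) => //;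
    exact: measurable_rat_box.
(* Boxes are enumerated by their codes; a number that codes no box contributes the empty set. *)
pose box n : option ((rat * rat) * (rat * rat)) := unpickle n.
pose N n := if box n is Some q then E1 q `|` E2 q else set0.
have nN : (@leb R).-negligible ((D `\` D0) `|` \bigcup_n N n).
  apply: negligibleU.
    by exists (D `\` D0); split => //; exact: measurableD.
  apply: negligible_bigcup => n; rewrite /N; case: (box n) => [q|].
    exact: negligibleU.
  exact: negligible_set0.
apply: negligibleS nN => x /=; apply: contra_notP => nNx Dx.
have D0x : D0 x by apply: contrapT => nD0; apply: nNx; left.
have boxE q : mu1 x (rat_box q) = mu2 x (rat_box q).
  apply: contrapT => neq; apply: nNx; right; exists (pickle q); first exact: I.
  rewrite /N /box pickleK.
  by case: (ltgtP (mu1 x (rat_box q)) (mu2 x (rat_box q))) neq => // lt12 _; [right|left].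
apply: measure_rat_box_unique => // q.
by rewrite (le_lt_trans (probability_le1 _ _)) ?ltry//; exact: measurable_rat_box.
Qed.

(** Sets and blocks are pulled back by [Psi], conditional measures pushed forward by [Phi]. In the
    integral formula [c] times [leb] is the pushforward of [leb] under [Psi], so no factor is
    left. *)
Lemma leb_disintegration_pushforward (R : realType)
    (Phi : {mfun plane R >-> plane R}) (Psi : plane R -> plane R) (c : R)
    (D : set (plane R)) (W : plane R -> set (plane R)) (D' : set (plane R))
    (mu : plane R -> probability (plane R) R) :
  cancel Phi Psi -> cancel Psi Phi -> measurable_fun setT Psi -> 0 <= c ->
  (forall A, measurable A -> leb (Psi @^-1` A) = (c%:E * leb A)%E) ->
  measurable D -> leb_disintegration D W D' mu ->
  leb_disintegration (Psi @^-1` D) (fun x => Psi @^-1` W (Psi x))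
    (Psi @^-1` D') (fun x => distribution (mu (Psi x)) Phi).
Proof.
move=> PhiK PsiK mPsi c0 lebPsi mD [[mD' D'D D'0] mmu muW muE nuE].
have mpre A : measurable A -> measurable (Psi @^-1` A).
  by move=> mA; rewrite -[X in measurable X]setTI; exact: mPsi.
have mpre' A : measurable A -> measurable (Phi @^-1` A).
  by move=> mA; rewrite -[X in measurable X]setTI; exact: measurable_funP.
have preK A : Phi @^-1` (Psi @^-1` A) = A.
  by rewrite -comp_preimage (_ : Psi \o Phi = id) ?preimage_id//; exact/funext.
have preK' A : Psi @^-1` (Phi @^-1` A) = A.
  by rewrite -comp_preimage (_ : Phi \o Psi = id) ?preimage_id//; exact/funext.
split.
- split; [exact: mpre|by move=> x; exact: D'D|].
  rewrite -[X in leb X]/(Psi @^-1` (D `\` D')) lebPsi; last exact: measurableD.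
  by rewrite D'0 mule0.
- move=> A mA; rewrite /distribution /pushforward.
  apply: (@measurable_comp _ _ _ _ _ _ D' (fun y => mu y (Phi @^-1` A))) => //.
  + by move=> _ [x D'x <-].
  + by apply: mmu; exact: mpre'.
  + exact: measurable_funS mPsi.
- move=> x /muW[B [mB B0 WB]]; exists (Psi @^-1` B); split.
  + exact: mpre.
  + by rewrite /= /distribution /pushforward preK.
  + by move=> y; exact: WB.
- by move=> x y D'x D'y Wxy A mA; apply: muE => //; exact: mpre'.
- move=> A mA.
  rewrite -{1}(preK' A) -preimage_setI lebPsi; last by apply: measurableI => //; exact: mpre'.
  rewrite nuE; last exact: mpre'.
  rewrite -(ge0_integral_mscale (@leb R) mD' (NngNum c0))//; last first.
    by apply: mmu; exact: mpre'.
  rewrite -[RHS](ge0_integral_pushforward mPsi (@leb R)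
    (f := fun y => mu y (Phi @^-1` A)))//; last by apply: mmu; exact: mpre'.
  by apply: eq_measure_integral => B mB _; rewrite [RHS]lebPsi.
Qed.

(** * Equivariance of the strips *)

(** Equality gives absolute continuity, so the derivative is the genuine one; it has the same
    integral as the constant 1 over every measurable set. *)
Lemma rn_derivative_eq1 (R : realType) (nu mu : probability (plane R) R) :
  (forall A, measurable A -> nu A = mu A) ->
  {ae mu, forall y, rn_derivative nu mu y = 1%E}.
Proof.
move=> numu.
have dom : charge_of_finite_measure nu `<< mu.
  by apply/null_content_dominatesP => A mA; rewrite /= numu.
have : ae_eq mu setT (rn_derivative nu mu) (cst 1%E).
  apply: integral_ae_eq => //; first exact: Radon_Nikodym_integrable.
  move=> A _ mA; rewrite -Radon_Nikodym_integral//= integral_cst// mul1e.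
  exact: numu.
by apply: filterS => y; exact.
Qed.

Lemma cancel_iter (T : Type) (f g : T -> T) (k : nat) :
  cancel f g -> cancel (iter k f) (iter k g).
Proof. by move=> fK; elim: k => // k IH x; rewrite iterSr /= fK IH. Qed.

(** Dropping finitely many terms does not change a limit. With the inverse map as [f] this also
    covers unstable leaves. *)
Lemma stable_set_iter (R : realType) (f : plane R -> plane R) (k : nat)
    (x y : plane R) :
  stable_set f (iter k f x) (iter k f y) <-> stable_set f x y.
Proof.
elim: k => // k IH; apply: iff_trans IH; rewrite !iterS.
move: (iter k f x) (iter k f y) => {}x {}y; rewrite /stable_set/=.
rewrite -(@cvg_shiftS _ (fun n => iter n f y - iter n f x)) /=.
by under eq_fun do rewrite -!iterSr !iterS.
Qed.

Lemma stable_set_iter0 (R : realType) (F : plane R -> plane R) (k : nat)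
    (q : plane R) : F 0 = 0 ->
  stable_set F 0 (iter k F q) <-> stable_set F 0 q.
Proof.
by move=> F0; rewrite -{1}(iter_fix k F0); exact: stable_set_iter.
Qed.

(** The iterate of [F] permutes the unstable leaves and preserves the stable leaf of the origin, so
    it carries intersection points to intersection points. *)
Lemma unstable_proj_iter (R : realType) (F G : plane R -> plane R) (k : nat)
    (z q : plane R) : cancel F G -> cancel G F -> F 0 = 0 ->
  unstable_proj F G (iter k F z) (iter k F q) <-> unstable_proj F G z q.
Proof.
move=> FK GK F0.
have FkK := @cancel_iter _ F G k FK; have GkK := @cancel_iter _ G F k GK.
have memE y : (stable_set G (iter k F z) `&` stable_set F 0) (iter k F y) <->
    (stable_set G z `&` stable_set F 0) y.
  rewrite /setI/= stable_set_iter0//.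
  by rewrite -(stable_set_iter G k (iter k F z)) !FkK.
rewrite /unstable_proj; split => /seteqP[sub sup]; apply/seteqP; split => y.
- by move=> /memE/sub/(can_inj FkK).
- by move=> ->; apply/memE/sup.
- by rewrite -(GkK y) => /memE/sub ->.
- by move=> ->; apply/memE/sup.
Qed.

Lemma strip_iter (R : realType) (F G : plane R -> plane R)
    (S : set (plane R)) (delta : R) (k : nat) : cancel F G -> cancel G F ->
  strip F G S delta k = iter k G @^-1` strip F G S delta 0.
Proof.
move=> FK GK; rewrite /strip/= image_id.
apply/seteqP; split => [_ [y sy <-]|y sy] /=; first by rewrite cancel_iter.
by exists (iter k G y) => //; rewrite cancel_iter.
Qed.

Lemma strip_leaf_iter (R : realType) (F G : plane R -> plane R)
    (S : set (plane R)) (delta : R) (k : nat) (x : plane R) :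
  cancel F G -> cancel G F ->
  strip_leaf F G S delta k x =
  iter k G @^-1` strip_leaf F G S delta 0 (iter k G x).
Proof.
move=> FK GK; rewrite /strip_leaf strip_iter// preimage_setI; congr setI.
by apply/seteqP; split => y /=; rewrite stable_set_iter.
Qed.

Lemma strip_box_iter (R : realType) (F G : plane R -> plane R)
    (S : set (plane R)) (delta : R) (k : nat) (U : set (plane R)) :
  cancel F G -> cancel G F -> F 0 = 0 ->
  strip_box F G S delta k (U `&` stable_set F 0) =
  iter k G @^-1` strip_box F G S delta 0
    (iter k F @^-1` U `&` stable_set F 0).
Proof.
move=> FK GK F0; rewrite /strip_box strip_iter//.
have FkK := @cancel_iter _ F G k FK; have GkK := @cancel_iter _ G F k GK.
apply/seteqP; split => z /= [sz [q zq [Uq sq]]]; split => //.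
- exists (iter k G q).
    by apply/(unstable_proj_iter k _ _ FK GK F0); rewrite !GkK.
  by split; rewrite /= ?GkK//; apply/(stable_set_iter0 k _ F0); rewrite GkK.
- exists (iter k F q).
    by rewrite -(GkK z); apply/(unstable_proj_iter k _ _ FK GK F0).
  by split => //; apply/(stable_set_iter0 k _ F0).
Qed.

(** * Almost everywhere equality of the conditional measures *)

Lemma bounded_image_ball (R : realType) (f : plane R -> plane R) (r : R)
    (A : set (plane R)) :
  continuous f -> A `<=` f @` ball (0 : plane R) r -> bounded_set A.
Proof.
move=> cf Ar; pose Q : set (plane R) := `[- r, r] `*` `[- r, r].
have cQ : compact Q by apply: compact_setX; exact: segment_compact.
have /compact_bounded : compact (f @` Q).
  by apply: continuous_compact => //; exact: continuous_subspaceT.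
apply: sub_boundedr => P QP _ /Ar[x [x1 x2] <-]; apply: QP; exists x => //.
move: x1 x2; rewrite -!ball_normE/= !sub0r !normrN => /ltW x1 /ltW x2.
by split; rewrite /= in_itv/= -ler_norml.
Qed.

Lemma leb_iter (R : realType) (G : plane R -> plane R) (J : R) (k : nat)
    (A : set (plane R)) : measurable_fun setT G ->
  (forall B, measurable B -> leb (G @^-1` B) = (J%:E * leb B)%E) ->
  measurable A -> leb (iter k G @^-1` A) = ((J ^+ k)%:E * leb A)%E.
Proof.
move=> mG lebG; elim: k A => [|k IH] A mA.
  by rewrite expr0 mul1e.
rewrite [X in leb X](_ : _ = iter k G @^-1` (G @^-1` A))//.
rewrite IH; last by rewrite -[X in measurable X]setTI; exact: mG.
by rewrite lebG// muleA -EFinM -exprSr.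
Qed.

Theorem lemma4p1 (R : realType) (f : torus R -> torus R)
    (F G : plane R -> plane R) (liftF : is_lift f F)
    (anosov_f : anosov_endomorphism f F) (C2_f : C2 F)
    (jac_f : constant_jacobian F)
    (FK : cancel F G) (GK : cancel G F) (F0 : F 0 = 0)
    (ubd_f : UBD (stable_set G))
    (orient_F : preserves_unstable_orientation F G)
    (S : set (plane R)) (side_S : is_side (stable_set F 0) S)
    (delta0 : R) (delta0_gt0 : 0 < delta0)
    (strip_onto : @torus_proj R @` strip F G S delta0 0%N = [set: torus R])
    (mu : nat -> plane R -> probability (plane R) R)
    (cond_mu : forall k, conditional_family F G S delta0 k (mu k)) :
  forall k : nat,
  {ae @leb R, forall x, strip F G S delta0 k x ->
    let nu := distribution (mu 0%N (iter k G x)) (lift_iter liftF k) in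
    {ae nu, forall y, rn_derivative (mu k x) nu y = 1%E}}.
Proof.
move=> k.
have [J FJ] := jac_f; have J0 : 0 <= J by rewrite -(FJ 0).
have dF x : differentiable F x by have [/(_ x I)[]] := C2_f.
have dG x : differentiable G x.
  by have [FC1 _] := anosov_f; exact: local_C1_diffeo_inverse_differentiable.
have cF : continuous F := liftF.1.
have cG : continuous G by move=> x; exact: differentiable_continuous.
have mG := continuous_plane_measurable cG.
have lebGk A : measurable A -> leb (iter k G @^-1` A) = ((J ^+ k)%:E * leb A)%E.
  by apply: leb_iter => // B; exact: leb_diffeo.
have FkK := @cancel_iter _ F G k FK; have GkK := @cancel_iter _ G F k GK.
have s0 : stable_set F 0 0.
  rewrite /stable_set/=; under eq_fun do rewrite subrr; exact: cvg_cst.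
(* Conditional measures are only given over bounded bases. Balls of radius [n.+1] exhaust the stable
   leaf of the origin, and each contains the origin, so no base is empty. *)
pose Dn n := strip_box F G S delta0 k (ball (0 : plane R) n.+1%:R `&` stable_set F 0).
have aen n : {ae @leb R, forall x, Dn n x -> forall A, measurable A ->
    mu k x A = distribution (mu 0%N (iter k G x)) (lift_iter liftF k) A}.
  have oU : open (ball (0 : plane R) n.+1%:R) by exact: ball_open.
  have U0 : ball (0 : plane R) n.+1%:R 0 by exact: ballxx.
  have [||mDk Dkoo [Dk disk]] := disintegration_leb (@cond_mu k _ oU _ _).
  - apply: (@bounded_image_ball R idfun n.+1%:R) => [y|y []]; first exact: cvg_id.
    by exists y.
  - by exists 0.
  (* The base at level 0 has to be the preimage of the base at level [k]; it is bounded since it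
     lies in the image of the ball under the continuous map [iter k G]. *)
  have oV : open (iter k F @^-1` ball (0 : plane R) n.+1%:R).
    by move/continuousP : (iter_continuous (k := k) cF); exact.
  have [||mD0 _ [D0 dis0]] := disintegration_leb (@cond_mu 0%N _ oV _ _).
  - apply: (@bounded_image_ball R (iter k G) n.+1%:R) => [|y [By _]].
      exact: iter_continuous.
    by exists (iter k F y).
  - by exists 0; split => //=; rewrite iter_fix.
  apply: (leb_disintegration_unique Dkoo mDk disk).
  rewrite strip_box_iter//.
  rewrite (_ : strip_leaf F G S delta0 k = fun x =>
      iter k G @^-1` strip_leaf F G S delta0 0 (iter k G x)); last first.
    by apply/funext => x; exact: strip_leaf_iter.
  apply: (leb_disintegration_pushforward (Phi := lift_iter liftF k) FkK GkK _ _ lebGk mD0 dis0).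
    by apply: continuous_plane_measurable; exact: iter_continuous.
  exact: exprn_ge0.
have nN := negligible_bigcup aen.
apply: negligibleS nN => x /=; apply: contra_notP => nNx sx.
apply: rn_derivative_eq1; have [y [_ [q yq yd]] yx] := sx.
have xq : unstable_proj F G x (iter k F q).
  by rewrite -yx; apply/(unstable_proj_iter k _ _ FK GK F0).
(* The projection [iter k F q] of [x] has norm less than [n.+1], so [x] lies in the box [Dn n]. *)
pose n := Num.truncn `|iter k F q|.
apply: contrapT => neq; apply: nNx; exists n => // /(_ _) aeq.
apply: neq; apply: aeq; split => //; exists (iter k F q) => //; split.
  by rewrite -ball_normE/= sub0r normrN; exact: truncnS_gt.
by have /seteqP[_ /(_ (iter k F q) erefl)[]] := xq.
Qed.
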